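(* Let $m,n\ge1$ be integers and let $\Theta=(\theta_j^i)_{1\le j\le n,\,1\le i\le m}$ be a real $n\times m$ matrix, with linear forms $L_j(\mathbf{x})=\sum_{i=1}^m\theta_j^ix_i$, $1\le j\le n$. For $\alpha=(\alpha_1,\dots,\alpha_n)\in\mathbb{R}^n$ and $\Gamma>0$ consider the system of inequalities $$S(\alpha,\Gamma):\qquad |L_j(\mathbf{x})-y_j-\alpha_j|<\frac{\Gamma}{X^{m/n}},\quad 1\le j\le n,\qquad X=\max_{1\le i\le m}|x_i|,$$ in integers $x_1,\dots,x_m,y_1,\dots,y_n$. Then the following two statements about $\Theta$ are equivalent: (i) for every $\alpha\in\mathbb{R}^n$ there exists $\Gamma>0$ such that for every $X_0>0$ the system $S(\alpha,\Gamma)$ has an integer solution with $X\ge X_0$; (ii) there exists $\Gamma>0$ such that for every $\alpha\in\mathbb{R}^n$ and every $X_0>0$ the system $S(\alpha,\Gamma)$ has an integer solution with $X\ge X_0$.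
   Context: Here $\mathbf{x}=(x_1,\dots,x_m)\in\mathbb{Z}^m$ and $(y_1,\dots,y_n)\in\mathbb{Z}^n$. In (i) the constant $\Gamma$ may depend on $\alpha$ (this is Khinchin's definition of $\Theta$ being a Chebyshev system); in (ii) the same $\Gamma$ serves all $\alpha$. *)

(* Defs.v *)
From mathcomp Require Import all_boot all_order all_algebra.
From mathcomp Require Import reals exp.

Set Implicit Arguments.
Unset Strict Implicit.
Unset Printing Implicit Defensive.

Import Order.TTheory GRing.Theory Num.Theory.
Local Open Scope ring_scope.

Definition linear_form (R : realType) (m n : nat) (Theta : 'M[R]_(n, m))
    (x : 'cV[int]_m) (j : 'I_n) : R :=
  \sum_(i < m) Theta j i * (x i 0)%:~R.

Definition height (m : nat) (x : 'cV[int]_m) : nat :=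
  (\max_(i < m) `|x i 0%R|)%N.

(* The exponent m / n is a quotient of reals.  When X = 0, the right-hand side
   is 0 and the system has no solution; this degenerate case never arises when
   X is required to be at least some X0 > 0. *)
Definition system_S (R : realType) (m n : nat) (Theta : 'M[R]_(n, m))
    (alpha : 'cV[R]_n) (Gamma : R) (x : 'cV[int]_m) (y : 'cV[int]_n) : Prop :=
  forall j : 'I_n,
    `|linear_form Theta x j - (y j 0)%:~R - alpha j 0|
      < Gamma / (height x)%:R `^ (m%:R / n%:R).

(* Main.v *)
Require Import Defs.
From mathcomp Require Import all_boot all_order all_algebra.
From mathcomp Require Import reals exp.
From mathcomp Require Import boolp classical_sets ring lra zify.

(** Call Theta singular when for every eps > 0 and every large T the
transposed forms take small values early: some nonzero integer vector u with
|u| <= eps * T^(m/n) has ||Theta^T u|| <= eps / T, where || || is the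
distance to the nearest integer vector.  Both statements of the theorem hold
when Theta is not singular, and both fail when it is.  As (ii) clearly implies
(i), it is enough to show that non-singularity gives (ii) and that
singularity refutes (i).

Not singular: then for some eps and for arbitrarily large T no such u exists.
This is a statement about short vectors of the lattice dual to that of the
points (x, Theta x - y), and it bounds the covering radius of the latter
([transference]): every alpha has an x with |x| bounded by a multiple of T and
||Theta x - alpha|| bounded by a multiple of T^(-m/n), uniformly in alpha.
Applying this to alpha - Theta x0, with x0 about twice as long as the bound on
x, forces the height of x + x0 to be of order T exactly, so that it is large
and the error is measured by its own height
([nonsingular_uniform_chebyshev]).  The covering bound ([covering]) is proved
by induction on the rank: split off a nearly shortest row, project the others
orthogonally to it, and use that projecting cannot shorten them much, because
a short projection would lift to a vector much shorter than that row.

Singular: on each box |u| <= b^i take an integer vector minimizing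
||Theta^T u||, and multiply it by an integer so that its height lands in
[b^i, 2 b^i].  The resulting sequence is lacunary, so some alpha keeps all the
scalar products u . alpha away from the integers
([lacunary_away_from_integers]).  For each large T one of these u is small
enough and nearly annihilates Theta, by singularity
([singular_separating_point]).  If |Theta x - y - alpha| were below
Gamma / T^(m/n) with T = |x|, then u . alpha would differ from an integer only
by x . (Theta^T u - v) - u . (Theta x - y - alpha), which is too small
([singular_not_chebyshev]). *)

Set Implicit Arguments.
Unset Strict Implicit.
Unset Printing Implicit Defensive.

Import Order.TTheory GRing.Theory Num.Theory.
Local Open Scope ring_scope.

Local Notation "A %:mxR" := (map_mx intr A) (at level 2, format "A %:mxR").

(** * Covering radius and dual minimum of a lattice *)

Lemma near_int (R : realType) (x : R) :
  exists k : int, `|x - k%:~R| <= 2^-1.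
Proof.
have /andP[h1 h2] := floor_itv (x + 2^-1).
exists (Num.floor (x + 2^-1)); rewrite intrD in h2.
by rewrite ler_norml; apply/andP; split; lra.
Qed.

Definition dot (R : realType) (N : nat) (u v : 'rV[R]_N) : R := (u *m v^T) 0 0.

Lemma dotE (R : realType) (N : nat) (u v : 'rV[R]_N) :
  dot u v = \sum_k u 0 k * v 0 k.
Proof. by rewrite /dot mxE; apply: eq_bigr => k _; rewrite mxE. Qed.

Lemma dotC (R : realType) (N : nat) (u v : 'rV[R]_N) : dot u v = dot v u.
Proof. by rewrite !dotE; apply: eq_bigr => k _; rewrite mulrC. Qed.

Lemma dotDZl (R : realType) (N : nat) (u v w : 'rV[R]_N) (a : R) :
  dot (u + a *: v) w = dot u w + a * dot v w.
Proof. by rewrite /dot mulmxDl -scalemxAl !mxE. Qed.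

Lemma sqnorm_coord (R : realType) (N : nat) (u : 'rV[R]_N) (k : 'I_N) :
  u 0 k ^+ 2 <= dot u u.
Proof.
rewrite dotE (bigD1 k) //= expr2 lerDl sumr_ge0 // => i _.
by rewrite -expr2 sqr_ge0.
Qed.

Lemma sqnorm_orth (R : realType) (N : nat) (u b : 'rV[R]_N) (a : R) :
  dot u b = 0 -> dot (u + a *: b) (u + a *: b) = dot u u + a ^+ 2 * dot b b.
Proof.
move=> ub.
by rewrite dotDZl dotC dotDZl (dotC b) (dotC b (_ + _)) dotDZl ub; ring.
Qed.

(** Rows of unimodular matrices are exactly the primitive integer vectors, so
this bounds below the primitive vectors of the lattice spanned by the rows of
A.  Speaking of rows of unimodular matrices gives at once a basis starting
with a chosen primitive vector. *)
Definition primitive_sqnorm_ge (R : realType) (d N : nat) (l : R)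
    (A : 'M[R]_(d, N)) : Prop :=
  forall (U : 'M[int]_d) i, U \in unitmx ->
    l <= dot (row i (U%:mxR *m A)) (row i (U%:mxR *m A)).

(** The size of a point p of R^d is measured by the least |v| with p = A v^T,
which is the norm dual to w |-> |w A|.  In these terms K bounds the square of
the covering radius of Z^d. *)
Definition covers (R : realType) (d N : nat) (K : R) (A : 'M[R]_(d, N)) : Prop :=
  forall p : 'cV[R]_d, exists (z : 'cV[int]_d) (v : 'rV[R]_N),
    p - z%:mxR = A *m v^T /\ dot v v <= K.

(** The inductive step, for a basis whose first vector b is shortest among the
primitive vectors up to a factor 2 in the squared length.  A projection of
squared length less than |b|^2 / 4 would lift to a vector of squared length
less than |b|^2 / 4 + |b|^2 / 4; so the projected rows satisfy the hypothesis
with l / 4.  The direction b itself adds at most 1 / |b| to the covering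
radius. *)
Lemma covering_step (R : realType) (d N : nat) (C l : R) (B : 'M[R]_(1 + d, N)) :
    0 < l ->
    (forall B' : 'M[R]_(d, N), primitive_sqnorm_ge (l / 4) B' ->
      covers (C / (l / 4)) B') ->
    l <= dot (usubmx B) (usubmx B) ->
    primitive_sqnorm_ge (dot (usubmx B) (usubmx B) / 2) B ->
  covers ((4 * C + 1) / l) B.
Proof.
move=> l0 IH; set b := usubmx B => lb bmin p.
have b0 : 0 < dot b b by apply: lt_le_trans lb.
have bN : dot b b != 0 by rewrite gt_eqF.
pose mu : 'cV[R]_d := (dot b b)^-1 *: (dsubmx B *m b^T).
pose B' : 'M[R]_(d, N) := dsubmx B - mu *m b.
have B'b : B' *m b^T = 0.
  apply/colP => i; rewrite mulmxBl -mulmxA !mxE big_ord1.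
  by rewrite -/(dot b b) !mxE mulrAC mulVf // mul1r subrr.
have BE : B = col_mx b (B' + mu *m b) by rewrite subrK vsubmxK.
have rowdot (V : 'M[int]_d) i : dot (row i (V%:mxR *m B')) b = 0.
  by rewrite /dot -row_mul -mulmxA B'b mulmx0 !mxE.
have hB' : primitive_sqnorm_ge (l / 4) B'.
  move=> V i Vu; have [t ht] := near_int ((V%:mxR *m mu) i 0).
  (* Row i of V B', lifted by the multiple of b nearest to its component
     along b, is again a primitive vector of B. *)
  pose W : 'M[int]_(1 + d) := block_mx 1%:M 0 (- t *: delta_mx i 0) V.
  have Wu : W \in unitmx.
    by rewrite unitmxE det_lblock det1 mul1r -unitmxE.
  have WE : row (rshift 1 i) (W%:mxR *m B) =
      row i (V%:mxR *m B') + ((V%:mxR *m mu) i 0 - t%:~R) *: b.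
    rewrite map_block_mx BE mul_block_col -row_dsubmx col_mxKd.
    rewrite mulmxDr mulmxA map_mxZ map_delta_mx rmorphN /=.
    apply/rowP => j; rewrite !mxE big_ord1 !mxE !eqxx /= mulr1 big_ord1.
    by rewrite [b _ _]mxE mxE addrC -addrA [in RHS]mulrDl.
  have := bmin W (rshift 1 i) Wu.
  rewrite WE sqnorm_orth //.
  set s := _ - _ in ht *; set D := dot (row _ _) _.
  have s2 : s ^+ 2 <= 4^-1.
    by move: ht; rewrite ler_norml => /andP[? ?]; nra.
  by move=> hh; nra.
(* Rounding the first coordinate of p fixes the component of v along b; what
   this contributes to the other coordinates is subtracted before the
   inductive hypothesis is used. *)
have [k hk] := near_int (p 0 0).
set s := _ - _ in hk.
have [z' [v' [zv' v'l]]] := IH B' hB' (dsubmx p - s *: mu).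
(* The component of v' along b is invisible to B'. *)
pose v2 := v' + (- (dot v' b / dot b b)) *: b.
have v2b : dot v2 b = 0.
  by rewrite dotDZl mulNr divfK // subrr.
have v2l : dot v2 v2 <= dot v' v'.
  have -> : v' = v2 + (dot v' b / dot b b) *: b.
    by rewrite /v2 -addrA -scalerDl addNr scale0r addr0.
  by rewrite sqnorm_orth // lerDl mulr_ge0 ?sqr_ge0 // ltW.
have B'v2 : B' *m v2^T = B' *m v'^T.
  by rewrite linearD /= linearZ /= mulmxDr -scalemxAr B'b scaler0 addr0.
exists (col_mx (const_mx k) z'), (v2 + (s / dot b b) *: b); split.
  rewrite BE mul_col_mx map_col_mx -[p]vsubmxK opp_col_mx add_col_mx.
  have bv : b *m (v2 + (s / dot b b) *: b)^T = s%:M.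
    apply/rowP => i; rewrite ord1 [LHS](_ : _ = dot b (v2 + (s / dot b b) *: b)) //.
    by rewrite dotC dotDZl v2b add0r divfK // mxE mulr1n.
  congr col_mx.
    rewrite bv; apply/rowP => i; rewrite ord1 !mxE /s mulr1n.
    by congr (p _ _ - _); apply/val_inj.
  rewrite mulmxDl -mulmxA bv mul_mx_scalar.
  rewrite linearD /= linearZ /= mulmxDr -scalemxAr B'b scaler0 addr0.
  by rewrite B'v2 -zv' [RHS]addrAC subrK.
rewrite sqnorm_orth // exprMn exprVn.
have s2 : s ^+ 2 <= 1.
  by move: hk; rewrite ler_norml => /andP[? ?]; nra.
have -> : s ^+ 2 * (dot b b ^+ 2)^-1 * dot b b = s ^+ 2 / dot b b.
  by field.
have h1 : s ^+ 2 / dot b b <= 1 / l.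
  apply: ler_pM => //; first exact: sqr_ge0; first by rewrite invr_ge0 ltW.
  by rewrite lef_pV2.
have -> : (4 * C + 1) / l = C / (l / 4) + 1 / l.
  by field; rewrite gt_eqF.
by apply: lerD h1; apply: le_trans v2l _.
Qed.

(** Covering radius of a lattice times first minimum of its dual is at most a
constant depending on the rank alone.  The first basis vector is a primitive
one whose squared length is below twice the infimum: the infimum is positive,
so such a vector exists even before the infimum is known to be attained. *)
Lemma covering (d : nat) : exists2 C : nat, (0 < C)%N &
  forall (R : realType) (N : nat) (l : R) (A : 'M[R]_(d, N)), 0 < l ->
    primitive_sqnorm_ge l A -> covers (C%:R / l) A.
Proof.
elim: d => [|d [C C0 IH]].
  exists 1%N => // R N l A l0 _ p; exists 0, 0; split.
    by apply/colP => -[].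
  by rewrite /dot mul0mx mxE divr_ge0 // ltW.
exists (4 * C + 1)%N; first lia.
move=> R N l A l0 hA p.
pose E : set R := [set x | exists (U : 'M[int]_d.+1) i,
  U \in unitmx /\ x = dot (row i (U%:mxR *m A)) (row i (U%:mxR *m A))]%classic.
have lE : lbound E l by move=> _ [U [i [Uu ->]]]; exact: hA.
have E0 : (E !=set0)%classic by eexists; exists 1%:M, 0; split; [exact: unitmx1|].
have infE : has_inf E by split => //; exists l.
have linf : l <= inf E by apply: lb_le_inf.
have inf0 : 0 < inf E by apply: lt_le_trans linf.
have [_ [U [i [Uu ->]]] hU] := inf_adherent inf0 infE.
(* Moving row i of U to the top makes the nearly shortest vector the first
   basis vector. *)
pose P : 'M[int]_d.+1 := perm_mx (perm.tperm i 0) *m U.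
have Pu : P \in unitmx by rewrite unitmx_mul unitmx_perm.
have intM (X Y : 'M[int]_d.+1) : (X *m Y)%:mxR = X%:mxR *m Y%:mxR :> 'M[R]_d.+1.
  by rewrite map_mxM.
pose B : 'M[R]_(1 + d, N) := P%:mxR *m A.
have uB : usubmx B = row i (U%:mxR *m A).
  rewrite /B intM -mulmxA map_perm_mx -row_permE.
  apply/rowP => j; rewrite !mxE.
  rewrite [lshift _ _](_ : _ = 0); last exact/val_inj.
  by rewrite perm.tpermR.
have lB : l <= dot (usubmx B) (usubmx B) by rewrite uB hA.
have minB : primitive_sqnorm_ge (dot (usubmx B) (usubmx B) / 2) B.
  move=> V j Vu; rewrite uB /B mulmxA -intM.
  have : inf E <= dot (row j ((V *m P)%:mxR *m A)) (row j ((V *m P)%:mxR *m A)).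
    by apply: ge_inf; [exists l | exists (V *m P), j; rewrite unitmx_mul Vu Pu].
  move=> h; rewrite ler_pdivrMr //; apply: ltW; apply: lt_le_trans hU _.
  by rewrite mulr_natr mulr2n lerD.
have l4 : 0 < l / 4 by rewrite divr_gt0.
have [z [v [zv hv]]] :=
  covering_step l0 (fun B' h => IH R N (l / 4) B' l4 h) lB minB (P%:mxR *m p).
exists (invmx P *m z), v; split; last first.
  by move: hv; rewrite natrD natrM.
have PV : (invmx P)%:mxR *m P%:mxR = 1%:M :> 'M[R]_d.+1.
  by rewrite -intM mulVmx // map_mx1.
rewrite map_mxM -[p in LHS]mul1mx -PV -mulmxA -mulmxBr zv /B.
by rewrite !mulmxA PV mul1mx.
Qed.

(** * Transference *)

Lemma height_coord (R : realType) (m : nat) (x : 'cV[int]_m) (i : 'I_m) :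
  `|(x i 0)%:~R| <= (height x)%:R :> R.
Proof.
by rewrite -intr_norm -natr_absz ler_nat; exact: (@leq_bigmax _ (fun i => absz (x i 0))).
Qed.

Lemma height_le (R : realType) (m : nat) (x : 'cV[int]_m) (r : R) :
  0 <= r -> (forall i, `|(x i 0)%:~R| <= r) -> (height x)%:R <= r.
Proof.
move=> r0 h; rewrite /height; elim/big_ind: _ => // [a b|i _].
  by rewrite /maxn; case: ifP.
by rewrite natr_absz intr_norm.
Qed.

Lemma height_gt0 (m : nat) (x : 'cV[int]_m) : x != 0 -> (0 < height x)%N.
Proof.
rewrite lt0n; apply: contra => /eqP h; apply/eqP/colP => i; rewrite mxE.
apply/eqP; rewrite -absz_eq0 -leqn0; apply: leq_trans (eq_leq h).
exact: (@leq_bigmax _ (fun i => absz (x i 0))).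
Qed.

Definition dual_approx (R : realType) (m n : nat) (Theta : 'M[R]_(n, m))
    (h d : R) (u : 'cV[int]_n) : Prop :=
  [/\ u != 0, (height u)%:R <= h &
    exists v : 'cV[int]_m,
      forall i, `|linear_form Theta^T u i - (v i 0)%:~R| <= d].

Lemma linear_form_mx (R : realType) (m n : nat) (Theta : 'M[R]_(n, m)) x j :
  linear_form Theta x j = (Theta *m x%:mxR) j 0.
Proof. by rewrite mxE; apply: eq_bigr => i _; rewrite mxE. Qed.

Lemma intr_lt1_eq0 (R : realType) (k : int) : `|k%:~R| < 1 :> R -> k = 0.
Proof. by rewrite -intr_norm ltrz1; lia. Qed.

(** The matrix A below spans, with rows indexed by v and u, the lattice of the
vectors ((v + Theta^T u) / d, u / h).  Failure of [dual_approx] says that its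
nonzero vectors have length at least 1 (for u = 0 this uses d < 1), and the
covering bound for the target (0, alpha) is the inhomogeneous approximation. *)
Lemma transference (m n : nat) : exists2 C : nat, (0 < C)%N &
  forall (R : realType) (Theta : 'M[R]_(n, m)) (h d : R), 0 < h -> 0 < d < 1 ->
    ~ (exists u, dual_approx Theta h d u) ->
  forall alpha : 'cV[R]_n, exists (x : 'cV[int]_m) (y : 'cV[int]_n),
    (height x)%:R <= C%:R / d /\
    forall j, `|linear_form Theta x j - (y j 0)%:~R - alpha j 0| <= C%:R / h.
Proof.
have [K K0 cov] := covering (m + n).
exists K => // R Theta h d h0 /andP[d0 d1] noapp alpha.
pose A : 'M[R]_(m + n) := block_mx (d^-1)%:M 0 (d^-1 *: Theta) (h^-1)%:M.
have hA (U : 'M[int]_(m + n)) i : U \in unitmx ->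
    1 <= dot (row i (U%:mxR *m A)) (row i (U%:mxR *m A)).
  move=> Uu; rewrite leNgt; apply/negP => lt1; apply: noapp.
  set w := row i _ in lt1.
  have w1 k : `|w 0 k| < 1.
    have := le_lt_trans (sqnorm_coord w k) lt1.
    by rewrite ltr_norml => hh; apply/andP; split; nra.
  pose a := lsubmx (row i U); pose u := rsubmx (row i U).
  have wE : w = row_mx (d^-1 *: (a%:mxR + u%:mxR *m Theta)) (h^-1 *: u%:mxR).
    rewrite /w row_mul -map_row -[row i U]hsubmxK -/a -/u map_row_mx mul_row_block.
    by rewrite mulmx0 add0r !mul_mx_scalar -scalemxAr scalerDr.
  have uh k : `|(u 0 k)%:~R| < h.
    move: (w1 (rshift m k)); rewrite wE row_mxEr !mxE normrM gtr0_norm ?invr_gt0 //.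
    by rewrite mulrC ltr_pdivrMr // mul1r.
  have ad k : `|(a 0 k)%:~R + (u%:mxR *m Theta) 0 k| < d.
    move: (w1 (lshift n k)); rewrite wE row_mxEl 3!mxE normrM gtr0_norm ?invr_gt0 //.
    by rewrite mulrC ltr_pdivrMr // mul1r mxE.
  exists u^T; split.
  - apply/negP => /eqP /(congr1 trmx); rewrite trmxK trmx0 => u0.
    have a0 : a = 0.
      apply/rowP => k; rewrite [RHS]mxE; apply: (@intr_lt1_eq0 R).
      move: (ad k); rewrite u0 map_mx0 mul0mx [X in _ + X]mxE addr0 => hh.
      exact: lt_trans d1.
    have r0 : row i U = 0 by rewrite -[row i U]hsubmxK -/a -/u a0 u0 row_mx0.
    have : row i U *m invmx U = row i 1%:M by rewrite -row_mul mulmxV.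
    by rewrite r0 mul0mx => /rowP /(_ i); rewrite !mxE eqxx.
  - by apply: height_le => [|k]; [exact: ltW|rewrite mxE ltW].
  - exists (- a^T) => k; rewrite linear_form_mx -map_trmx -trmx_mul mxE [(- a^T) _ _]mxE [a^T _ _]mxE.
    by rewrite rmorphN opprK addrC ltW // ad.
(* The first block of the covering relation makes d^-1 a an integer vector:
   it is the solution x, bounded because |a| is; the second block is its error. *)
have [z [v [zv hv]]] := cov R _ 1 A ltr01 hA (col_mx 0 alpha).
rewrite divr1 in hv.
have vK k : `|v 0 k| <= K%:R.
  have h1 : v 0 k ^+ 2 <= K%:R := le_trans (sqnorm_coord v k) hv.
  have K1 : 1 <= K%:R :> R by rewrite ler1n.
  by rewrite ler_norml; apply/andP; split; nra.
move: zv; rewrite -[z]vsubmxK -[v]hsubmxK tr_row_mx mul_block_col.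
set z1 := usubmx z; set z2 := dsubmx z; set a := lsubmx v; set b := rsubmx v.
rewrite map_col_mx opp_col_mx add_col_mx => /eq_col_mx[].
rewrite add0r mul0mx addr0 !mul_scalar_mx -scalemxAl => z1E z2E.
have z1a : a^T = - d *: z1%:mxR.
  by rewrite scaleNr -scalerN z1E scalerA divff ?scale1r // gt_eqF.
exists (- z1), (- z2); split.
  apply: height_le => [|i]; first by rewrite divr_ge0 ?ler0n ?ltW.
  rewrite [(- z1) _ _]mxE rmorphN normrN ler_pdivlMr //.
  have /colP /(_ i) := z1a; rewrite [LHS]mxE [RHS]mxE [_%:mxR _ _]mxE [a _ _]mxE => aE.
  have := vK (lshift n i); rewrite aE mulNr normrN normrM gtr0_norm //.
  by rewrite mulrC.
move=> j; rewrite linear_form_mx [(- z2) _ _]mxE rmorphN /= opprK.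
move: z2E; rewrite z1a scalemxAr scalerA mulrN mulVf ?gt_eqF // scaleN1r.
move=> /esym /(canRL (addrK _)) z2E; rewrite map_mxN z2E.
have -> : (alpha - z2%:mxR - h^-1 *: b^T) j 0 + (z2 j 0)%:~R - alpha j 0
    = - (h^-1 * v 0 (rshift m j)).
  by rewrite !mxE; ring.
rewrite normrN normrM gtr0_norm ?invr_gt0 // mulrC ler_wpM2r // invr_ge0 ltW //.
Qed.

(** * Non-singular matrices satisfy (ii) *)

Definition singular (R : realType) (m n : nat) (Theta : 'M[R]_(n, m)) : Prop :=
  forall eps : R, 0 < eps -> exists T0 : R, forall T : R, T0 <= T ->
    exists u, dual_approx Theta (eps * T `^ (m%:R / n%:R)) (eps / T) u.

(** A dual gap at T yields solutions of height O(T) for every alpha; a shift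
by a fixed vector of height of order T makes the height comparable to T from
below as well, which is what the bound in terms of X itself requires. *)
Lemma nonsingular_uniform_chebyshev (R : realType) (m n : nat)
    (Theta : 'M[R]_(n, m)) : (1 <= m)%N -> ~ singular Theta ->
  exists Gamma : R, 0 < Gamma /\
    forall (alpha : 'cV[R]_n) (X0 : R), 0 < X0 ->
      exists (x : 'cV[int]_m) (y : 'cV[int]_n),
        system_S Theta alpha Gamma x y /\ X0 <= (height x)%:R.
Proof.
move=> hm /existsNP[eps /not_implyP[eps0 /forallNP nons]].
have [C C0 trans] := transference m n.
pose s : R := m%:R / n%:R; pose M : R := C%:R / eps.
have s0 : 0 <= s by rewrite divr_ge0 ?ler0n.
have M0 : 0 < M by rewrite divr_gt0 ?ltr0n.
have G0 : 0 < M * (4 * M) `^ s + 1.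
  by rewrite ltr_wpDl // mulr_ge0 ?powR_ge0 // ltW.
exists (M * (4 * M) `^ s + 1); split => // alpha X0 X00.
have /existsNP[T /not_implyP[hT noapp]] := nons (1 + eps + M^-1 + X0 / M).
have XM0 : 0 < X0 / M by rewrite divr_gt0.
have Mi0 : 0 < M^-1 by rewrite invr_gt0.
have [T0 Teps TM' TX'] : [/\ 0 < T, eps < T, M^-1 <= T & X0 / M <= T].
  by move: hT XM0 Mi0; set p := X0 / M; set q := M^-1 => *; split; lra.
have TM : 1 <= M * T by rewrite mulrC -ler_pdivrMr // div1r.
have TX : X0 <= M * T by rewrite mulrC -ler_pdivrMr.
have Ts0 : 0 < T `^ s by rewrite powR_gt0.
have /andP[k1 k2] := floor_itv (2 * (M * T)).
(* The shift: k exceeds twice the bound M T on the height of x, so the height of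
   x + x0 lies between M T and 4 M T. *)
pose k := Num.floor (2 * (M * T)) + 1.
have kE : k%:~R = (Num.floor (2 * (M * T)))%:~R + 1 :> R by rewrite intrD.
rewrite -/k in k2.
pose i0 := Ordinal hm.
pose x0 : 'cV[int]_m := k *: delta_mx i0 0.
have h0 : 0 < eps * T `^ s by rewrite mulr_gt0.
have d01 : 0 < eps / T < 1 by rewrite divr_gt0 //= ltr_pdivrMr // mul1r.
have [x [y [xh xy]]] := trans R Theta _ _ h0 d01 noapp (alpha - Theta *m x0%:mxR).
have {}xh : (height x)%:R <= M * T.
  by apply: le_trans xh _; rewrite /M invf_div mulrA mulrAC.
have xi i : `|(x i 0)%:~R| <= M * T by apply: le_trans (height_coord R x i) xh.
have hlow : M * T <= (height (x + x0))%:R.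
  apply: le_trans (height_coord R (x + x0) i0).
  rewrite !mxE !eqxx /= mulr1 rmorphD /= ler_normr; apply/orP; left.
  by move: (xi i0); rewrite ler_norml => /andP[]; lra.
have hupp : (height (x + x0))%:R <= 4 * M * T.
  apply: height_le => [|i]; first by rewrite -mulrA mulr_ge0 // ltW // mulr_gt0.
  rewrite !mxE rmorphD rmorphM /=; move: (xi i); rewrite !ler_norml => /andP[? ?].
  by case: (i == i0) => /=; rewrite ?mulr1 ?mulr0; apply/andP; split; lra.
exists (x + x0), y; split; last exact: le_trans hlow.
move=> j; move: (xy j); rewrite !linear_form_mx map_mxD mulmxDr.
rewrite [(Theta *m _ + Theta *m _) j 0]mxE [(alpha - _) j 0]mxE [(- (Theta *m _)) j 0]mxE.
set a := (Theta *m _) j 0; set b := (Theta *m _) j 0 => ab.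
have -> : a + b - (y j 0)%:~R - alpha j 0 = a - (y j 0)%:~R - (alpha j 0 - b) by ring.
apply: le_lt_trans ab _; rewrite -/s.
have X1 : 0 < (height (x + x0))%:R :> R by apply: lt_le_trans X00 (le_trans TX hlow).
rewrite invfM mulrA -/M ltr_pdivrMr // mulrAC ltr_pdivlMr ?powR_gt0 //.
have hs : (height (x + x0))%:R `^ s <= (4 * M) `^ s * T `^ s.
  have M4 : 0 <= 4 * M by rewrite mulr_ge0 // ltW.
  rewrite -powRM //; last exact: ltW.
  by apply: ge0_ler_powR => //; rewrite nnegrE ?ler0n // mulr_ge0 // ltW.
apply: le_lt_trans (ler_wpM2l (ltW M0) hs) _.
by rewrite [X in _ < X]mulrDl mulrA mul1r ltrDl.
Qed.

(** * Keeping lacunary scalar products away from the integers *)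

(** The intervals of centre a i and radius r i are nested, and L is a common
point. *)
Lemma nested_intervals_limit (R : realType) (a r : nat -> R) :
    (forall i, 0 <= r i) -> (forall i, `|a i.+1 - a i| <= r i - r i.+1) ->
  exists L, forall i, `|L - a i| <= r i.
Proof.
move=> r0 ar.
have lo i k : (i <= k)%N -> a i - r i <= a k - r k.
  move: i k; apply: (homo_leq (r := <=%R) (f := fun i => a i - r i)) => [x|y x z|i].
  - exact: lexx.
  - exact: le_trans.
  by move: (ar i); rewrite ler_norml => /andP[]; lra.
have hi i k : (i <= k)%N -> a k + r k <= a i + r i.
  move=> ik; rewrite -lerN2; move: i k ik.
  apply: (homo_leq (r := <=%R) (f := fun i => - (a i + r i))) => [x|y x z|i].
  - exact: lexx.
  - exact: le_trans.
  by move: (ar i); rewrite ler_norml => /andP[]; lra.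
have lohi i k : a i - r i <= a k + r k.
  have h1 := lo i (maxn i k) (leq_maxl _ _).
  have h2 := hi k (maxn i k) (leq_maxr _ _).
  by have := r0 (maxn i k); lra.
pose E : set R := [set x | exists i, x = a i - r i]%classic.
have E0 : (E !=set0)%classic by exists (a 0%N - r 0%N), 0%N.
exists (sup E) => i; rewrite ler_norml.
have h1 : a i - r i <= sup E.
  by apply: ub_le_sup; [exists (a 0%N + r 0%N) => _ [k ->] | exists i].
have h2 : sup E <= a i + r i by apply: ge_sup => // _ [k ->].
by apply/andP; split; lra.
Qed.

Definition pairing (R : realType) (n : nat) (u : 'cV[int]_n) (a : 'cV[R]_n) : R :=
  \sum_j (u j 0)%:~R * a j 0.

Lemma height_attained (n : nat) (u : 'cV[int]_n) :
  (0 < height u)%N -> exists j, height u = absz (u j 0).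
Proof.
case: n u => [|n] u; first by rewrite /height big_ord0.
move=> _; have [|j hj] := @bigop.eq_bigmax _ (fun j : 'I_n.+1 => absz (u j 0)).
  by rewrite card_ord.
by exists j.
Qed.

(** Moving a single coordinate, one where u is largest, changes u . a by up
to 1/2 at a cost of at most 1 / (2 |u|). *)
Lemma half_integer_shift (R : realType) (n : nat) (u : 'cV[int]_n) (B : R)
    (a : 'cV[R]_n) : 0 < B -> B <= (height u)%:R ->
  exists a' : 'cV[R]_n, (forall j, `|a' j 0 - a j 0| <= (2 * B)^-1) /\
    exists k : int, pairing u a' = k%:~R + 2^-1.
Proof.
move=> B0 Bu.
have u0 : (0 < height u)%N by rewrite -(ltr0n R); apply: lt_le_trans Bu.
have [j0 hj0] := height_attained u0.
have Bj : B <= `|(u j0 0)%:~R| by rewrite -intr_norm -natr_absz -hj0.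
have uj0 : (u j0 0)%:~R != 0 :> R by rewrite -normr_gt0; apply: lt_le_trans Bj.
have [k hk] := near_int (pairing u a - 2^-1).
pose t := (k%:~R + 2^-1 - pairing u a) / (u j0 0)%:~R.
exists (a + t *: delta_mx j0 0); split => [j|].
  rewrite !mxE addrAC subrr add0r eqxx andbT.
  have tB : `|t| <= (2 * B)^-1.
    have -> : t = - ((pairing u a - 2^-1 - k%:~R) / (u j0 0)%:~R).
      by rewrite -mulNr; congr (_ / _); ring.
    rewrite normrN normrM normfV invfM; apply: ler_pM => //.
      by rewrite invr_ge0.
    by rewrite lef_pV2 ?posrE ?normr_gt0.
  case: (j == j0); rewrite /= ?mulr1 ?mulr0 //.
  by rewrite normr0 invr_ge0 mulr_ge0 // ltW.
exists k; rewrite /pairing.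
under eq_bigr do rewrite !mxE mulrDr.
rewrite big_split /= -/(pairing u a) (bigD1 j0) //= big1 => [|j /negPf ->].
  by rewrite eqxx mulr1 addr0 mulrC divfK // addrC subrK.
by rewrite /= !mulr0.
Qed.

Lemma half_integer_dist (R : realType) (k l : int) :
  2^-1 <= `|k%:~R + 2^-1 - l%:~R| :> R.
Proof.
rewrite ler_normr; have [kl|lk] := lerP l k.
  by rewrite -(ler_int R) in kl; apply/orP; left; lra.
by rewrite -lezD1 -(ler_int R) intrD in lk; apply/orP; right; lra.
Qed.

(** Successive corrections make u_i . a_i a half-integer.  The corrections of
index beyond i move each coordinate by at most
sum over l > i of 1 / (2 b^l) = 1 / (2 (b - 1) b^i), hence move u_i . alpha by
at most n / (b - 1); the base b = 4 n + 1 makes this 1/4. *)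
Lemma lacunary_away_from_integers (R : realType) (n : nat) (u : nat -> 'cV[int]_n) :
    (1 <= n)%N -> (forall i, (4 * n + 1) ^ i <= height (u i) <= 2 * (4 * n + 1) ^ i)%N ->
  exists alpha : 'cV[R]_n, forall i (k : int), 4^-1 <= `|pairing (u i) alpha - k%:~R|.
Proof.
move=> n1; set b := (4 * n + 1)%N => hu.
have nR : 0 < n%:R :> R by rewrite ltr0n.
have bE : b%:R = 4 * n%:R + 1 :> R by rewrite natrD natrM.
have b0 : 0 < b%:R :> R by rewrite ltr0n /b addn1.
have bX i : 0 < b%:R ^+ i :> R by rewrite exprn_gt0.
pose P (ia : nat * 'cV[R]_n) (a' : 'cV[R]_n) :=
  (forall j, `|a' j 0 - ia.2 j 0| <= (2 * b%:R ^+ ia.1)^-1) /\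
    exists k : int, pairing (u ia.1) a' = k%:~R + 2^-1.
have /choice[F hF] : forall ia, exists a', P ia a'.
  move=> [i a]; apply: half_integer_shift => //=.
  by rewrite -natrX ler_nat; case/andP: (hu i).
pose a := fix a i := F (i, if i is i'.+1 then a i' else 0).
(* 8 n = 2 (b - 1): r i is the sum of all corrections of index beyond i. *)
pose r i : R := (8 * n%:R * b%:R ^+ i)^-1.
have r0 i : 0 <= r i by rewrite invr_ge0 !mulr_ge0 ?ler0n // ltW.
have ar j i : `|a i.+1 j 0 - a i j 0| <= r i - r i.+1.
  have [/(_ j) /= h _] := hF (i.+1, a i).
  apply: le_trans h _; rewrite /r exprS; have := bX i.
  set B := _ ^+ i => B0; rewrite bE le_eqVlt; apply/orP; left; apply/eqP.
  by field; rewrite !gt_eqF //; lra.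
have /choice[L hL] : forall j, exists L, forall i, `|L - a i j 0| <= r i.
  by move=> j; apply: nested_intervals_limit.
exists (\col_j L j) => i k.
have [_ [k0 /= hk0]] := hF (i, if i is i'.+1 then a i' else 0).
have {}hk0 : pairing (u i) (a i) = k0%:~R + 2^-1 by rewrite -hk0; case: (i).
pose D := \sum_j (u i j 0)%:~R * (L j - a i j 0).
have DE : pairing (u i) (\col_j L j) = k0%:~R + 2^-1 + D.
  rewrite -hk0 -big_split /=; apply: eq_bigr => j _.
  by rewrite mxE -mulrDr addrC subrK.
have hD : `|D| <= 4^-1.
  apply: le_trans (ler_norm_sum _ _ _) _.
  have hj j : `|(u i j 0)%:~R * (L j - a i j 0)| <= (4 * n%:R)^-1.
    have -> : (4 * n%:R)^-1 = (2 * b%:R ^+ i) * r i.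
      by rewrite /r; field; rewrite !gt_eqF.
    rewrite normrM; apply: ler_pM => //.
    apply: le_trans (height_coord R (u i) j) _.
    by rewrite -natrX -natrM ler_nat; case/andP: (hu i).
  apply: le_trans (ler_sum _ (fun j _ => hj j)) _.
  rewrite sumr_const card_ord -mulr_natr le_eqVlt; apply/orP; left; apply/eqP.
  by field; rewrite gt_eqF.
rewrite DE; have := half_integer_dist R k0 k.
have := ler_normB (k0%:~R + 2^-1 + D - k%:~R) D.
have -> : k0%:~R + 2^-1 + D - k%:~R - D = k0%:~R + 2^-1 - k%:~R by ring.
set x := `|_|; set y := `|_| ; lra.
Qed.

(** * Singular matrices violate (i) *)

(** A minimum, and not just an infimum, is needed: one vector per box must
serve every T at once, also when the infimum is 0. *)
Lemma box_minimizer (R : realType) (n K : nat) (F : 'cV[int]_n -> R) :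
    (0 < n)%N -> (0 < K)%N ->
  exists w, [/\ w != 0, (height w <= K)%N &
    forall u, u != 0 -> (height u <= K)%N -> F w <= F u].
Proof.
move=> n0 K0.
pose g (f : {ffun 'I_n -> 'I_(2 * K).+1}) : 'cV[int]_n := \col_j ((f j)%:Z - K%:Z).
have gK f : (height (g f) <= K)%N.
  apply/bigmax_leqP => j _; rewrite mxE; have := ltn_ord (f j); lia.
have gsurj u : (height u <= K)%N -> exists f, u = g f.
  move=> /bigmax_leqP uK.
  exists [ffun j => inord (absz (u j 0 + K%:Z))]; apply/colP => j.
  by rewrite !mxE ffunE inordK; have := uK j isT; lia.
pose f0 : {ffun 'I_n -> 'I_(2 * K).+1} := [ffun=> ord_max].
have gf0 : g f0 != 0.
  apply/negP => /eqP/colP /(_ (Ordinal n0)); rewrite !mxE ffunE /=; lia.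
case: (@Order.TotalTheory.arg_minP _ _ _ f0 (fun f => g f != 0) (F \o g) gf0) => f fN fmin.
exists (g f); split => // u uN /gsurj[f' uE].
by rewrite uE; apply: fmin; rewrite -uE.
Qed.

(** ||Theta^T u||: floor (x + 1/2) is an integer nearest to x. *)
Definition dual_err (R : realType) (m n : nat) (Theta : 'M[R]_(n, m))
    (u : 'cV[int]_n) : R :=
  \big[Num.max/0]_i
    `|linear_form Theta^T u i - (Num.floor (linear_form Theta^T u i + 2^-1))%:~R|.

Lemma floor_half_nearest (R : realType) (x : R) (k : int) :
  `|x - (Num.floor (x + 2^-1))%:~R| <= `|x - k%:~R|.
Proof.
have /andP[] := floor_itv (x + 2^-1); set f := Num.floor _; rewrite intrD => h1 h2.
have norm_ge (y z : R) : `|y| <= z \/ `|y| <= - z -> `|y| <= `|z|.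
  by rewrite ler_normr => -[] ->; rewrite ?orbT.
case: (ltgtP f k) => [fk|fk|->//]; move: fk; rewrite -lezD1 -(ler_int R) intrD => fk;
  apply: norm_ge; [right|left]; rewrite ler_norml; apply/andP; split; lra.
Qed.

Lemma dual_errP (R : realType) (m n : nat) (Theta : 'M[R]_(n, m)) u (d : R) :
  0 <= d ->
  (dual_err Theta u <= d <->
   exists v : 'cV[int]_m, forall i, `|linear_form Theta^T u i - (v i 0)%:~R| <= d).
Proof.
move=> d0; split => [ud|[v hv]].
  exists (\col_i Num.floor (linear_form Theta^T u i + 2^-1)) => i; rewrite mxE.
  by apply: le_trans ud; exact: (@le_bigmax _ _ _ 0 (fun i =>
    `|linear_form Theta^T u i - (Num.floor (linear_form Theta^T u i + 2^-1))%:~R|)).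
by apply: bigmax_le => // i _; apply: le_trans (floor_half_nearest _ (v i 0)) (hv i).
Qed.

Lemma heightZ (n q : nat) (u : 'cV[int]_n) : height (q%:Z *: u) = (q * height u)%N.
Proof.
rewrite /height; under eq_bigr do rewrite mxE abszM absz_nat.
by elim/big_ind2: _ => [|a b c e -> ->|//]; rewrite ?muln0 // maxnMr.
Qed.

Lemma dual_approxZ (R : realType) (m n q : nat) (Theta : 'M[R]_(n, m)) (h d : R) u :
    (0 < q)%N -> dual_approx Theta h d u ->
  dual_approx Theta (q%:R * h) (q%:R * d) (q%:Z *: u).
Proof.
move=> q0 [uN uh [v uv]]; split.
- apply/negP => /eqP q0u; have : (0 < height (q%:Z *: u))%N.
    by rewrite heightZ muln_gt0 q0 height_gt0.
  by rewrite q0u /height big1 // => i _; rewrite mxE.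
- by rewrite heightZ natrM ler_wpM2l.
exists (q%:Z *: v) => i; rewrite !linear_form_mx map_mxZ -scalemxAr mxE -linear_form_mx.
by rewrite [(_ *: v) _ _]mxE intrM -mulrBr normrM ger0_norm ?ler_wpM2l ?ler0z.
Qed.

(** Let w_i minimize ||Theta^T w|| over nonzero vectors of height at most b^i,
and scale it to u_i of height between b^i and 2 b^i.  Given T, use the least i
for which ||Theta^T w_i|| meets the bound that singularity provides at T for
some short vector u1.  If i > 0, then w_i and u1 both lie outside the box of
index i - 1.  For w_i this bounds the scaling factor by b, so the scaling costs
only a constant; for u1 it bounds b^i, hence the height of u_i, by a constant
times the height of u1. *)
Lemma singular_separating_point (R : realType) (m n : nat) (Theta : 'M[R]_(n, m)) :
    (1 <= n)%N -> singular Theta ->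
  exists alpha : 'cV[R]_n, forall eps : R, 0 < eps ->
    exists T0 : R, forall T, T0 <= T -> exists u,
      dual_approx Theta (eps * T `^ (m%:R / n%:R)) (eps / T) u /\
      forall k : int, 4^-1 <= `|pairing u alpha - k%:~R|.
Proof.
move=> n1 sing; set b := (4 * n + 1)%N.
have b1 : (1 < b)%N by rewrite /b; lia.
have bX i : (0 < b ^ i)%N by rewrite expn_gt0; lia.
have /choice[w hw] : forall i, exists w, [/\ w != 0, (height w <= b ^ i)%N &
    forall u, u != 0 -> (height u <= b ^ i)%N -> dual_err Theta w <= dual_err Theta u].
  by move=> i; apply: box_minimizer.
pose q i := (b ^ i %/ height (w i)).+1.
pose u i := (q i)%:Z *: w i.
have hu i : (b ^ i <= height (u i) <= 2 * b ^ i)%N.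
  have [wN wh _] := hw i; have h0 := height_gt0 wN.
  rewrite heightZ /q; have := divn_eq (b ^ i) (height (w i)).
  by have := ltn_pmod (b ^ i) h0; lia.
have [alpha halpha] := @lacunary_away_from_integers R n u n1 hu.
exists alpha => eps eps0.
have b0 : 0 < b%:R :> R by rewrite ltr0n; lia.
have e'0 : 0 < eps / (2 * b%:R) by rewrite divr_gt0 // mulr_gt0.
have [T1 hT1] := sing _ e'0.
exists (Num.max T1 1) => T; rewrite ge_max => /andP[TT1 T1'].
have T0 : 0 < T by apply: lt_le_trans T1'.
have [u1 [u1N u1h u1v]] := hT1 T TT1.
set s := m%:R / n%:R in u1h *.
pose tau := eps / (2 * b%:R) / T.
have tau0 : 0 <= tau by rewrite ltW // divr_gt0.
have u1e : dual_err Theta u1 <= tau by apply/dual_errP.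
have ex : exists i, dual_err Theta (w i) <= tau.
  exists (height u1); have [_ _ wmin] := hw (height u1).
  by apply: le_trans (wmin u1 u1N _) u1e; apply/ltnW/ltn_expl.
case: (ex_minnP ex) => i wi imin.
have [wN wh wmin] := hw i.
have [q2 ui] : (q i <= 2 * b)%N /\ (2 * b ^ i <= 2 * b * height u1)%N.
  case: i imin wi wN wh wmin => [|i] imin wi wN wh wmin.
    rewrite /q expn0; split.
      apply: (@leq_trans 2); first by rewrite ltnS leq_div.
      by rewrite leq_pmulr // ltnW.
    by rewrite -mulnA leq_mul2l /= muln_gt0 (ltnW b1) height_gt0.
  have [w'N w'h w'min] := hw i.
  have w'e : tau < dual_err Theta (w i).
    by rewrite ltNge; apply/negP => /imin; rewrite ltnn.
  (* Below the minimum over the box of index i means outside that box. *)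
  have far v : v != 0 -> dual_err Theta v <= tau -> (b ^ i < height v)%N.
    move=> vN ve; rewrite ltnNge; apply/negP => /(w'min _ vN) h.
    by have := lt_le_trans w'e (le_trans h ve); rewrite ltxx.
  have h1 := far _ u1N u1e; have h2 := far _ wN wi.
  split; last by rewrite expnS mulnA leq_mul2l ltnW ?orbT.
  rewrite /q; suff : (b ^ i.+1 %/ height (w i.+1) < b)%N.
    by move=> h; apply: leq_trans h _; rewrite leq_pmull.
  by rewrite ltn_divLR ?height_gt0 // expnS ltn_mul2l h2 andbT ltnW.
exists (u i); split; last exact: halpha.
have [v hv] := (dual_errP Theta (w i) tau0).1 wi.
have [uN _ [v' uv']] : dual_approx Theta ((q i)%:R * (height (w i))%:R) ((q i)%:R * tau) (u i).
  by apply: dual_approxZ => //; split => //; exists v.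
split => //.
  have /andP[_ h] := hu i; have {h} := leq_trans h ui; rewrite -(ler_nat R) => h.
  apply: le_trans h _; rewrite !natrM.
  apply: le_trans (ler_wpM2l _ u1h) _; first by rewrite mulr_ge0 // ltW.
  by rewrite le_eqVlt; apply/orP; left; apply/eqP; field; rewrite gt_eqF.
exists v' => k; apply: le_trans (uv' k) _.
rewrite -(ler_nat R) natrM in q2.
apply: le_trans (ler_wpM2r tau0 q2) _.
by rewrite le_eqVlt /tau; apply/orP; left; apply/eqP; field; rewrite !gt_eqF.
Qed.

Lemma linear_form_transpose (R : realType) (m n : nat) (Theta : 'M[R]_(n, m))
    (u : 'cV[int]_n) (x : 'cV[int]_m) :
  \sum_j (u j 0)%:~R * linear_form Theta x j =
  \sum_i (x i 0)%:~R * linear_form Theta^T u i :> R.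
Proof.
under eq_bigr do rewrite mulr_sumr.
rewrite exchange_big /=; apply: eq_bigr => i _.
by rewrite mulr_sumr; apply: eq_bigr => j _; rewrite mxE; ring.
Qed.

(** Expanding u . (Theta x - y - alpha) with the integer k below writes
u . alpha - k as D1 - D2, where D1 is controlled by ||Theta^T u|| and D2 by the
inequalities of the system.  With eps = 1 / (8 (m + n Gamma)) their sum is at
most 1/8, while u . alpha stays at distance 1/4 from k. *)
Lemma singular_not_chebyshev (R : realType) (m n : nat) (Theta : 'M[R]_(n, m)) :
    (1 <= n)%N -> singular Theta ->
  exists alpha : 'cV[R]_n, forall Gamma : R, 0 < Gamma ->
    exists2 X0 : R, 0 < X0 & forall x y,
      system_S Theta alpha Gamma x y -> ~ X0 <= (height x)%:R.
Proof.
move=> n1 /(singular_separating_point n1)[alpha halpha].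
exists alpha => Gamma G0.
have n0 : 0 < n%:R :> R by rewrite ltr0n.
pose c : R := m%:R + n%:R * Gamma.
have c0 : 0 < c by rewrite ltr_wpDl // mulr_gt0.
have e0 : 0 < (8 * c)^-1 by rewrite invr_gt0 mulr_gt0.
have [T0 hT0] := halpha _ e0.
exists (Num.max T0 1); first by rewrite lt_max ltr01 orbT.
move=> x y xy; rewrite ge_max => /andP[XT X1].
set T : R := (height x)%:R in XT X1.
have T1 : 0 < T by apply: lt_le_trans X1.
have [u [[_ uh [v uv]] ualpha]] := hT0 T XT.
set s := m%:R / n%:R in uh.
have Ts : 0 < T `^ s by rewrite powR_gt0.
pose k := \sum_i x i 0 * v i 0 - \sum_j u j 0 * y j 0.
have := ualpha k; apply/negP; rewrite -ltNge.
pose D1 := \sum_i (x i 0)%:~R * (linear_form Theta^T u i - (v i 0)%:~R).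
pose D2 := \sum_j (u j 0)%:~R * (linear_form Theta x j - (y j 0)%:~R - alpha j 0).
have -> : pairing u alpha - k%:~R = D1 - D2.
  have -> : k%:~R = \sum_i (x i 0)%:~R * (v i 0)%:~R
                    - \sum_j (u j 0)%:~R * (y j 0)%:~R :> R.
    by rewrite intrB !rmorph_sum /=; congr (_ - _); apply: eq_bigr => i _;
      rewrite intrM.
  have -> : D1 = \sum_i (x i 0)%:~R * linear_form Theta^T u i
                 - \sum_i (x i 0)%:~R * (v i 0)%:~R.
    by rewrite -sumrB; apply: eq_bigr => i _; rewrite mulrBr.
  have -> : D2 = \sum_j (u j 0)%:~R * linear_form Theta x j
                 - \sum_j (u j 0)%:~R * (y j 0)%:~R - pairing u alpha.
    by rewrite -!sumrB; apply: eq_bigr => i _; rewrite !mulrBr.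
  by rewrite (linear_form_transpose Theta u x); ring.
have hD1 : `|D1| <= m%:R * (8 * c)^-1.
  apply: le_trans (ler_norm_sum _ _ _) _.
  have h i : `|(x i 0)%:~R * (linear_form Theta^T u i - (v i 0)%:~R)| <= (8 * c)^-1.
    rewrite normrM; apply: le_trans (ler_pM _ _ (height_coord R x i) (uv i)) _ => //.
    by rewrite -/T mulrC divfK // gt_eqF.
  apply: le_trans (ler_sum _ (fun i _ => h i)) _.
  by rewrite sumr_const card_ord [X in _ <= X]mulr_natl.
have hD2 : `|D2| <= n%:R * ((8 * c)^-1 * Gamma).
  apply: le_trans (ler_norm_sum _ _ _) _.
  have h j : `|(u j 0)%:~R * (linear_form Theta x j - (y j 0)%:~R - alpha j 0)|
      <= (8 * c)^-1 * Gamma.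
    rewrite normrM.
    apply: le_trans (ler_pM _ _ (le_trans (height_coord R u j) uh) (ltW (xy j))) _ => //.
    rewrite -/T -/s le_eqVlt; apply/orP; left; apply/eqP.
    by field; rewrite !gt_eqF.
  apply: le_trans (ler_sum _ (fun j _ => h j)) _.
  by rewrite sumr_const card_ord [X in _ <= X]mulr_natl.
apply: le_lt_trans (ler_normB _ _) _.
apply: le_lt_trans (lerD hD1 hD2) _.
have -> : m%:R * (8 * c)^-1 + n%:R * ((8 * c)^-1 * Gamma) = 8^-1.
  by rewrite /c in c0 *; field; rewrite gt_eqF.
by rewrite ltf_pV2 ?posrE // ltr_nat.
Qed.

Theorem theorem2 (R : realType) (m n : nat) (hm : (1 <= m)%N) (hn : (1 <= n)%N)
    (Theta : 'M[R]_(n, m)) :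
  (forall alpha : 'cV[R]_n, exists Gamma : R, 0 < Gamma /\
     forall X0 : R, 0 < X0 ->
       exists (x : 'cV[int]_m) (y : 'cV[int]_n),
         system_S Theta alpha Gamma x y /\ X0 <= (height x)%:R)
  <->
  (exists Gamma : R, 0 < Gamma /\
     forall (alpha : 'cV[R]_n) (X0 : R), 0 < X0 ->
       exists (x : 'cV[int]_m) (y : 'cV[int]_n),
         system_S Theta alpha Gamma x y /\ X0 <= (height x)%:R).
Proof.
split=> [cheb | [Gamma [G0 unif]] alpha]; last first.
  by exists Gamma; split=> // X0; apply: unif.
apply: nonsingular_uniform_chebyshev => // /(singular_not_chebyshev hn)[alpha bad].
have [Gamma [G0 sol]] := cheb alpha.
have [X0 X00 nosol] := bad Gamma G0.
have [x [y [xy Xx]]] := sol X0 X00.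
exact: nosol xy Xx.
Qed.
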